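(* Let $\Sigma=\{a,b\}$, $L=\Sigma^+$, and let $h:\Sigma^*\to M_{36}$ be the morphism onto the finite monoid defined in the context. Put $P_a=[a]$, $P_q=[baaa]$, $P_b=[b]$, $P_{ab}=[ab]$ (relative classes of $(L,h)$). Then for every integer $m\ge0$ the production $$P_{ab}\to P_a\,P_q^{\,m}\,P_b$$ (whose right-hand side is $P_a$ followed by $m$ copies of $P_q$ followed by $P_b$) is valid. In particular $P_a,P_q,P_b,P_{ab}$ are relative primes.
   Context: The monoid. Let $Q_0=\{0,1,2,3\}$. A transformation $f:Q_0\to Q_0$ is written as the tuple $(f(0),f(1),f(2),f(3))$, and products of transformations are composed from left to right: $(fg)(x)=g(f(x))$. Put $\tau_a=(1,2,0,0)$, $\tau_b=(1,3,1,0)$, and let $M_0$ be the submonoid (containing the identity) of the full transformation monoid on $Q_0$ generated by $\tau_a,\tau_b$. Let $h_0:\{a,b\}^*\to M_0$ be the morphism with $h_0(a)=\tau_a$, $h_0(b)=\tau_b$. Let $\sim_0$ be the least monoid congruence on $M_0$ with $h_0(ab)\sim_0 h_0(abaaab)$, let $M_{36}=M_0/{\sim_0}$, let $\pi_0:M_0\to M_{36}$ be the projection, and $h=\pi_0\circ h_0$. General definitions, for $L\subseteq\Sigma^*$ and a monoid morphism $h:\Sigma^*\to M$ into a finite monoid. $D_L(x)=\{(u,v):uxv\in L\}$; $x\equiv_L y$ iff $D_L(x)=D_L(y)$. The relative syntactic congruence $\theta$ is: $x\,\theta\,y$ iff $x\equiv_L y$ and $h(x)=h(y)$; its classes $[x]$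 are called relative classes. A relative class is live if $D_L(x)\neq\varnothing$ for its members. The unit class is $[\varepsilon]$. For relative classes $X,Y$: $X\cdot Y=\{xy:x\in X,y\in Y\}$ (exact setwise product), and $X*Y=[xy]$ for any $x\in X,y\in Y$ (quotient product). A relative prime is a live relative class $P\ne[\varepsilon]$ such that whenever $P=X\cdot Y$ (equality of sets) for relative classes $X,Y$, one of $X,Y$ is $[\varepsilon]$. For a sequence $\alpha=P_1\cdots P_k$ ($k\ge 2$) of relative primes and a relative prime $P$, the production $P\to\alpha$ is correct if $P_1*\cdots*P_k=P$. The sequence $\alpha$ is pleonastic if it has a proper contiguous block $P_i\cdots P_j$ of length $\ge2$ whose quotient product $P_i*\cdots*P_j$ is a relative prime. A correct production $P\to\alpha$ is valid if $\alpha$ is not pleonastic. *)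

(* Defs.v *)
From HB Require Import structures.
From mathcomp Require Import all_boot.
From mathcomp Require Import boolp classical_sets.

Set Implicit Arguments.
Unset Strict Implicit.
Unset Printing Implicit Defensive.

Local Open Scope group_scope.
Local Open Scope quotient_scope.

#[short(type="finMonoidType")]
HB.structure Definition FinMonoid := {M of Monoid M & Finite M}.

(* The free monoid on an alphabet. The alias carries the monoid structure:
   [seq] itself has none. *)

Definition word (Sigma : finType) := seq Sigma.

HB.instance Definition _ (Sigma : finType) := Choice.on (word Sigma).
HB.instance Definition _ (Sigma : finType) :=
  isMonoid.Build (word Sigma) (@catA Sigma) (@cat0s Sigma) (@cats0 Sigma).

Section Generation.
Context (T : finMonoidType).

Definition submonoid (S : {set T}) : bool :=
  (1 \in S) && [forall x in S, forall y in S, x * y \in S].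

Definition submonoid_gen (A : {set T}) : {set T} :=
  (\bigcap_(S : {set T} | submonoid S && (A \subset S)) S)%SET.

Lemma submonoid_gen_closed A : monoid_closed (submonoid_gen A).
Proof.
split=> [|x y /bigcapP Sx /bigcapP Sy]; apply/bigcapP=> S.
  by case/andP=> /andP[].
move=> SA; case/andP: (SA) => /andP[_ /forall_inP SM] _.
by move/forall_inP: (SM x (Sx S SA)); apply; apply: Sy.
Qed.

Lemma sub_submonoid_gen (A : {set T}) x : x \in A -> x \in submonoid_gen A.
Proof.
by move=> Ax; apply/bigcapP=> S /andP[_ /fintype.subsetP]; apply.
Qed.

(* A relation on T is given by its graph. *)
Definition congruence (R : {set T * T}) : bool :=
  [&& [forall x, (x, x) \in R],
      [forall x, forall y, ((x, y) \in R) ==> ((y, x) \in R)],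
      [forall x, forall y, forall z,
         ((x, y) \in R) && ((y, z) \in R) ==> ((x, z) \in R)] &
      [forall x, forall x', forall y, forall y',
         ((x, x') \in R) && ((y, y') \in R) ==> ((x * y, x' * y') \in R)]].

Definition least_congruence (p : T * T) : {set T * T} :=
  (\bigcap_(R : {set T * T} | congruence R && (p \in R)) R)%SET.

Definition least_cong (p : T * T) : rel T :=
  fun x y => (x, y) \in least_congruence p.

Lemma least_cong_refl p : reflexive (least_cong p).
Proof.
by move=> x; apply/bigcapP=> R /andP[/and4P[/forallP RR _ _ _] _]; apply: RR.
Qed.

Lemma least_cong_sym p : symmetric (least_cong p).
Proof.
suff sym x y : least_cong p x y -> least_cong p y x.
  by move=> x y; apply/idP/idP; apply: sym.
move=> /bigcapP xy; apply/bigcapP=> R cR.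
have /andP[/and4P[_ /forallP/(_ x)/forallP/(_ y)/implyP RS _ _] _] := cR.
exact/RS/xy.
Qed.

Lemma least_cong_trans p : transitive (least_cong p).
Proof.
move=> y x z /bigcapP xy /bigcapP yz; apply/bigcapP=> R cR.
have /andP[/and4P[_ _ RT _] _] := cR.
move: RT => /forallP/(_ x)/forallP/(_ y)/forallP/(_ z)/implyP; apply.
by rewrite xy ?yz.
Qed.

Lemma least_congM p x x' y y' :
  least_cong p x x' -> least_cong p y y' -> least_cong p (x * y) (x' * y').
Proof.
move=> /bigcapP xx /bigcapP yy; apply/bigcapP=> R cR.
have /andP[/and4P[_ _ _ RM] _] := cR.
move: RM => /forallP/(_ x)/forallP/(_ x')/forallP/(_ y)/forallP/(_ y').
by move/implyP; apply; rewrite xx ?yy.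
Qed.

End Generation.

(* Transformations compose from left to right: (f * g) x = g (f x). The alias
   keeps this product apart from the pointwise one on {ffun _ -> _}. *)

Definition transf := {ffun 'I_4 -> 'I_4}.
HB.instance Definition _ := Finite.on transf.

Definition transf_mul (f g : transf) : transf := [ffun x => g (f x)].
Definition transf_one : transf := [ffun x => x].

Fact transf_mulA : associative transf_mul.
Proof. by move=> f g k; apply/ffunP=> x; rewrite !ffunE. Qed.

Fact transf_mul1 : left_id transf_one transf_mul.
Proof. by move=> f; apply/ffunP=> x; rewrite !ffunE. Qed.

Fact transf_mulr1 : right_id transf_one transf_mul.
Proof. by move=> f; apply/ffunP=> x; rewrite !ffunE. Qed.

HB.instance Definition _ :=
  isMonoid.Build transf transf_mulA transf_mul1 transf_mulr1.

Definition q0 : 'I_4 := @Ordinal 4 0 isT.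
Definition q1 : 'I_4 := @Ordinal 4 1 isT.
Definition q2 : 'I_4 := @Ordinal 4 2 isT.
Definition q3 : 'I_4 := @Ordinal 4 3 isT.

Definition transf_of (t : 4.-tuple 'I_4) : transf := [ffun x => tnth t x].

Definition tau_a : transf := transf_of [tuple q1; q2; q0; q0].
Definition tau_b : transf := transf_of [tuple q1; q3; q1; q0].

Definition M0_set : {set transf} := submonoid_gen [set tau_a; tau_b]%SET.
Definition M0 := {f : transf | f \in M0_set}.

HB.instance Definition _ := SubFinite.on M0.
HB.instance Definition _ :=
  SubChoice_isSubMonoid.Build transf (fun f => f \in M0_set) M0
    (submonoid_gen_closed _).

Fact tau_a_M0 : tau_a \in M0_set.
Proof. by apply: sub_submonoid_gen; rewrite !inE eqxx. Qed.

Fact tau_b_M0 : tau_b \in M0_set.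
Proof. by apply: sub_submonoid_gen; rewrite !inE eqxx orbT. Qed.

Inductive letter := La | Lb.

Definition letter_is_a (c : letter) : bool := if c is La then true else false.
Definition letter_of_bool (x : bool) : letter := if x then La else Lb.
Fact letter_is_aK : cancel letter_is_a letter_of_bool. Proof. by case. Qed.
HB.instance Definition _ := Finite.copy letter (can_type letter_is_aK).

Definition h0_letter (c : letter) : M0 :=
  match c with La => Sub tau_a tau_a_M0 | Lb => Sub tau_b tau_b_M0 end.

Definition h0 (w : word letter) : M0 := \prod_(c <- w) h0_letter c.

Fact h0_is_monoid_morphism : monoid_morphism h0.
Proof. by split=> [|v w]; rewrite /h0 ?big_nil ?big_cat. Qed.

HB.instance Definition _ :=
  isUMagmaMorphism.Build (word letter) M0 h0 h0_is_monoid_morphism.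

Definition sim0 : rel M0 :=
  least_cong (h0 [:: La; Lb], h0 [:: La; Lb; La; La; La; Lb]).

Canonical sim0_equiv : equiv_rel M0 :=
  EquivRel sim0 (@least_cong_refl _ _) (@least_cong_sym _ _)
    (@least_cong_trans _ _).

Definition M36 := {eq_quot sim0}.

HB.instance Definition _ := EqQuotient.on M36.
HB.instance Definition _ := Choice.on M36.
HB.instance Definition _ := Countable.on M36.
HB.instance Definition _ : isFinite M36 :=
  CanIsFinite (@reprK M0 M36).

Definition pi0 (x : M0) : M36 := \pi_M36 x.

Definition M36_one : M36 := pi0 1.
Definition M36_mul (X Y : M36) : M36 := pi0 (repr X * repr Y).

Fact pi0K X : pi0 (repr X) = X.
Proof. exact: reprK. Qed.

Fact pi0_mul x y : pi0 (x * y) = M36_mul (pi0 x) (pi0 y).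
Proof.
apply/eqmodP; rewrite /= /sim0.
by apply: least_congM; apply/(@eqmodP _ sim0_equiv); rewrite reprK.
Qed.

Fact M36_mulA : associative M36_mul.
Proof.
move=> X Y Z; rewrite -(pi0K X) -(pi0K Y) -(pi0K Z) -!pi0_mul.
by rewrite mulgA.
Qed.

Fact M36_mul1 : left_id M36_one M36_mul.
Proof. by move=> X; rewrite -(pi0K X) -pi0_mul mul1g. Qed.

Fact M36_mulr1 : right_id M36_one M36_mul.
Proof. by move=> X; rewrite -(pi0K X) -pi0_mul mulg1. Qed.

HB.instance Definition _ :=
  isMonoid.Build M36 M36_mulA M36_mul1 M36_mulr1.

Fact pi0_is_monoid_morphism : monoid_morphism pi0.
Proof. by split=> // x y; apply: pi0_mul. Qed.

HB.instance Definition _ :=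
  isUMagmaMorphism.Build M0 M36 pi0 pi0_is_monoid_morphism.

Definition h : UMagmaMorphism.type (word letter) M36 := pi0 \o h0.

Local Open Scope classical_set_scope.

Section RelativeClasses.
Context (Sigma : finType) (M : finMonoidType).
Context (L : set (word Sigma)) (phi : UMagmaMorphism.type (word Sigma) M).

Definition contexts (x : word Sigma) : set (word Sigma * word Sigma) :=
  [set uv | L (uv.1 ++ x ++ uv.2)].

Definition synt_eq (x y : word Sigma) : Prop := contexts x = contexts y.

Definition rel_synt (x y : word Sigma) : Prop := synt_eq x y /\ phi x = phi y.

Definition rel_class (x : word Sigma) : set (word Sigma) :=
  [set y | rel_synt x y].

Definition is_rel_class (X : set (word Sigma)) : Prop :=
  exists x, X = rel_class x.

Definition live (X : set (word Sigma)) : Prop :=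
  forall x, X x -> contexts x <> set0.

Definition unit_class : set (word Sigma) := rel_class [::].

Definition set_mul (X Y : set (word Sigma)) : set (word Sigma) :=
  [set x ++ y | x in X & y in Y].

(* The union of the classes [xy] for x in X and y in Y; when X and Y are
   relative classes these all coincide, see [quot_mul_class]. *)
Definition quot_mul (X Y : set (word Sigma)) : set (word Sigma) :=
  [set z | exists x y, [/\ X x, Y y & rel_class (x ++ y) z]].

Definition quot_prod (alpha : seq (set (word Sigma))) : set (word Sigma) :=
  foldr quot_mul unit_class alpha.

Definition rel_prime (P : set (word Sigma)) : Prop :=
  [/\ is_rel_class P, live P, P <> unit_class &
      forall X Y, is_rel_class X -> is_rel_class Y -> P = set_mul X Y ->
        X = unit_class \/ Y = unit_class].

Definition production (P : set (word Sigma)) (alpha : seq (set (word Sigma))) :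
    Prop :=
  [/\ rel_prime P, (2 <= size alpha)%N &
      forall Q, Q \in alpha -> rel_prime Q].

Definition correct (P : set (word Sigma)) (alpha : seq (set (word Sigma))) :
    Prop :=
  production P alpha /\ quot_prod alpha = P.

Definition pleonastic (alpha : seq (set (word Sigma))) : Prop :=
  exists s1 s s2, [/\ alpha = s1 ++ s ++ s2, (2 <= size s < size alpha)%N &
    rel_prime (quot_prod s)].

Definition valid (P : set (word Sigma)) (alpha : seq (set (word Sigma))) :
    Prop :=
  correct P alpha /\ ~ pleonastic alpha.

Lemma rel_synt_cat x x' y y' :
  rel_synt x x' -> rel_synt y y' -> rel_synt (x ++ y) (x' ++ y').
Proof.
move=> [xx px] [yy py]; split; last first.
  have phiM (u v : word Sigma) : phi (u ++ v) = phi u * phi v := gmulfM u v.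
  by rewrite !phiM px py.
apply/seteqP; split=> -[u v] /=; rewrite /contexts /=.
- have /seteqP[xx1 _] := xx; have /seteqP[yy1 _] := yy.
  rewrite -!catA => Luv; have /= := xx1 (u, y ++ v); rewrite /contexts /=.
  move=> /(_ Luv); rewrite catA => Luv'.
  by have /= := yy1 (u ++ x', v) Luv'; rewrite /contexts /= -!catA.
- have /seteqP[_ xx1] := xx; have /seteqP[_ yy1] := yy.
  rewrite -!catA => Luv; have /= := xx1 (u, y' ++ v); rewrite /contexts /=.
  move=> /(_ Luv); rewrite catA => Luv'.
  by have /= := yy1 (u ++ x, v) Luv'; rewrite /contexts /= -!catA.
Qed.

Lemma quot_mul_class x y :
  quot_mul (rel_class x) (rel_class y) = rel_class (x ++ y).
Proof.
apply/seteqP; split=> z /=.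
  move=> [x' [y' [xx yy [c p]]]]; have [c' p'] := rel_synt_cat xx yy.
  by split; [rewrite /synt_eq c' | rewrite p'].
by move=> xyz; exists x, y; split.
Qed.

Lemma quot_prod_class (ws : seq (word Sigma)) :
  quot_prod (map rel_class ws) = rel_class (flatten ws).
Proof. by elim: ws => //= w ws IH; rewrite IH quot_mul_class. Qed.

End RelativeClasses.

Definition Sigma_plus : set (word letter) := [set w | w != [::]].

Definition P_a := rel_class Sigma_plus h [:: La].
Definition P_q := rel_class Sigma_plus h [:: Lb; La; La; La].
Definition P_b := rel_class Sigma_plus h [:: Lb].
Definition P_ab := rel_class Sigma_plus h [:: La; Lb].

(* Main.v *)
Require Import Defs.
From mathcomp Require Import all_boot.
From mathcomp Require Import boolp classical_sets.

Set Implicit Arguments.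
Unset Strict Implicit.
Unset Printing Implicit Defensive.

(* On nonempty words the relative classes are the fibres of h, so everything
   happens in M36. There, two elements of M0 are identified only if they are
   equal or if one is obtained from the other by exchanging two values that
   contain its image; in particular elements of rank at least 3 stay alone in
   their class, which separates the factors needed for primality. Writing
   q = baaa, the defining relation a q b ~ ab absorbs copies of q: a q^m b ~ ab,
   a q^i ~ a q (i >= 1), q^i ~ q^2 (i >= 2), q^i b ~ q b (i >= 1). So a proper
   block of the right-hand side has class [aq], [qq] or [qb], and these factor
   exactly as [abaa][a], [b][aaabaaa] and [b][aaab]. *)

(** * Relative classes of nonempty words, and tests for primality *)

Lemma h_cat (u v : word letter) : h (u ++ v) = (h u * h v)%g.
Proof. exact: gmulfM. Qed.

(** For [Sigma_plus] every nonempty word has all contexts, while the empty word lacks the empty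
    context; contexts tell nothing else apart. *)
Lemma rel_classP (x y : word letter) :
  x != [::] ->
  rel_class Sigma_plus h x y <-> y != [::] /\ h x = h y.
Proof.
move=> x0.
have ctxT (z : word letter) : z != [::] -> contexts Sigma_plus z = setT.
  move=> z0; apply/seteqP; split=> // -[u v] _ /=.
  by rewrite /contexts /Sigma_plus /=; case: u z z0 => [|? ?] [|? ?].
split=> [[exy hxy]|[y0 hxy]]; last by split=> //; rewrite /synt_eq !ctxT.
split=> //; apply/negP=> /eqP y_nil.
have : contexts Sigma_plus y ([::], [::]) by rewrite -exy ctxT.
by rewrite y_nil.
Qed.

Lemma rel_class_refl (x : word letter) : rel_class Sigma_plus h x x.
Proof. by []. Qed.

Lemma eq_rel_class (x y : word letter) :
  x != [::] -> y != [::] -> h x = h y ->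
  rel_class Sigma_plus h x = rel_class Sigma_plus h y.
Proof.
move=> x0 y0 hxy; apply/seteqP; split=> z /rel_classP.
  by move=> /(_ x0)[z0 hz]; apply/rel_classP => //; rewrite -hxy.
by move=> /(_ y0)[z0 hz]; apply/rel_classP => //; rewrite hxy.
Qed.

Lemma rel_class_neq_unit (x : word letter) :
  x != [::] -> rel_class Sigma_plus h x <> unit_class Sigma_plus h.
Proof.
move=> x0 eX; have : rel_class Sigma_plus h x [::].
  by rewrite eX; apply: rel_class_refl.
by move/(rel_classP _ x0) => [].
Qed.

(* A common decomposition of a class transports to each of its members. *)
Lemma rel_prime_witness (x : word letter) :
    x != [::] ->
    (forall i, 0 < i < size x ->
       exists2 w, w != [::] /\ h x = h w &
       forall u v, w = u ++ v ->
         h (take i x) = h u -> h (drop i x) = h v -> False) ->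
  rel_prime Sigma_plus h (rel_class Sigma_plus h x).
Proof.
move=> x0 wit; split; first by exists x.
- move=> y /(rel_classP _ x0)[y0 _] c0.
  have : contexts Sigma_plus y ([::], [::]).
    by rewrite /contexts /Sigma_plus /= cats0.
  by rewrite c0.
- exact: rel_class_neq_unit.
move=> _ _ [x1 ->] [x2 ->] eP.
have [->|x1n] := eqVneq x1 [::]; first by left.
have [->|x2n] := eqVneq x2 [::]; first by right.
(* The split of [x] itself shows that the two factors are the classes of a prefix and a suffix of
   [x]. *)
have : rel_class Sigma_plus h x x by apply: rel_class_refl.
rewrite eP => -[u /(rel_classP _ x1n)[u0 hu]].
move=> [v /(rel_classP _ x2n)[v0 hv] uv].
have size_u : 0 < size u < size x.
  by rewrite -uv size_cat lt0n size_eq0 u0 -ltn_subLR // subnn lt0n size_eq0.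
have [w /(rel_classP _ x0) Pw] := wit _ size_u.
rewrite -uv take_size_cat // drop_size_cat // => nw.
move: Pw; rewrite eP => -[u' /(rel_classP _ x1n)[_ hu']].
move=> [v' /(rel_classP _ x2n)[_ hv'] uv'].
by case: (nw u' v' (esym uv')); [rewrite -hu | rewrite -hv].
Qed.

(** The product of the two classes lies in that of [x] because [h] is a morphism; [dec] supplies the
    converse inclusion. *)
Lemma not_rel_prime_cat (x y z : word letter) :
    y != [::] -> z != [::] -> h x = h (y ++ z) ->
    (forall w, h x = h w ->
       exists u v,
         [/\ w = u ++ v, u != [::], v != [::], h y = h u & h z = h v]) ->
  x != [::] -> ~ rel_prime Sigma_plus h (rel_class Sigma_plus h x).
Proof.
move=> y0 z0 hx dec x0 [_ _ _].
move=> /(_ (rel_class Sigma_plus h y) (rel_class Sigma_plus h z)).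
case; [by exists y | by exists z | | exact: rel_class_neq_unit..].
apply/seteqP; split=> w.
  move=> /(rel_classP _ x0)[_ /dec[u [v [-> u0 v0 hu hv]]]].
  by exists u; [apply/rel_classP | exists v; [apply/rel_classP|]].
move=> [u /(rel_classP _ y0)[u0 hu]] [v /(rel_classP _ z0)[v0 hv] <-].
apply/rel_classP => //; split; first by case: u u0 {hu}.
by rewrite hx !h_cat hu hv.
Qed.

(** * Transformations as computable lists *)

(* On plain naturals, so that it computes. *)
Definition act (i : nat) (c : letter) : nat :=
  nth 0 (if c is La then [:: 1; 2; 0; 0] else [:: 1; 3; 1; 0]) i.

Definition code (w : word letter) : seq nat :=
  [seq foldl act i w | i <- iota 0 4].

Lemma h0_act (w : word letter) (i : 'I_4) :
  val (h0 w) i = foldl act i w :> nat.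
Proof.
elim: w i => [|c w IH] i; first by rewrite /h0 big_nil ffunE.
rewrite /h0 big_cons -/(h0 w) /= ffunE IH; congr foldl.
by case: c; rewrite ffunE (tnth_nth q0) /=; case: i => -[|[|[|[|]]]].
Qed.

Lemma nth_code (w : word letter) i : i < 4 -> nth 0 (code w) i = foldl act i w.
Proof. by case: i => [|[|[|[|]]]]. Qed.

Lemma eq_h_code (u v : word letter) : code u = code v -> h u = h v.
Proof.
move=> uv; congr pi0; apply: val_inj; apply/ffunP=> i; apply: val_inj.
by rewrite /= !h0_act -!nth_code // uv.
Qed.

(** * Equality in [M36] *)

Lemma h_aqb :
  h [:: La; Lb; La; La; La; Lb] = h [:: La; Lb].
Proof.
apply/eqmodP; rewrite /= /sim0 least_cong_sym.
by apply/bigcapP=> R /andP[].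
Qed.

Lemma h_aqb_cat (u v : word letter) :
  h (u ++ [:: La; Lb; La; La; La; Lb] ++ v) = h (u ++ [:: La; Lb] ++ v).
Proof. by rewrite !h_cat h_aqb. Qed.

(* Equality or [swapped] is a monoid congruence: it therefore contains [sim0]. *)
Definition swapped (T S : Type) (f g : T -> S) : Prop :=
  exists p q, forall x, f x = p /\ g x = q \/ f x = q /\ g x = p.

(** If [g] takes two values, both exchanges concern these and cancel. If [g] is constant, so are [f]
    and [k], and any two constants are swapped. *)
Lemma swapped_trans (T S : Type) (f g k : T -> S) :
  swapped f g -> swapped g k -> f =1 k \/ swapped f k.
Proof.
move=> [p [q fg]] [p' [q' gk]].
have [[x fkx]|] := pselect (exists x, f x <> k x); last first.
  by move=> /forallNP eqfk; left=> x; apply: contrapT; apply: eqfk.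
right; exists (f x), (k x) => y.
by move: (fg x) (gk x) (fg y) (gk y) => [] [? ?] [] [? ?] [] [? ?] [] [? ?];
  (try by left; split; congruence); (try by right; split; congruence);
  exfalso; apply: fkx; congruence.
Qed.

Lemma sim0_swapped (f g : M0) :
  sim0 f g -> val f = val g \/ swapped (val f) (val g).
Proof.
pose S (f g : M0) := val f = val g \/ swapped (val f) (val g).
have S_sym f' g' : S f' g' -> S g' f'.
  by case=> [e|[p [q H]]]; [left | right; exists q, p => x; case: (H x); tauto].
have S_trans k f' g' : S f' k -> S k g' -> S f' g'.
  case=> [e|H]; first by rewrite /S e.
  case=> [e|H']; first by rewrite /S -e; right.
  by have [/ffunP|] := swapped_trans H H'; [left | right].
have SM f1 f2 g1 g2 : S f1 f2 -> S g1 g2 -> S (f1 * g1)%g (f2 * g2)%g.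
  (* One factor at a time: composing with [g1] afterwards maps the exchanged pair forward, composing
     with [f2] beforehand keeps it. *)
  move=> Sf Sg; apply: (S_trans (f2 * g1)%g).
    case: Sf => [e|[p [q H]]].
      by left; apply/ffunP=> x; rewrite !ffunE /= e.
    right; exists (val g1 p), (val g1 q) => x.
    by rewrite !ffunE; case: (H x) => -[-> ->]; [left | right].
  case: Sg => [e|[p [q H]]].
    by left; apply/ffunP=> x; rewrite !ffunE /= e.
  by right; exists p, q => x; rewrite !ffunE; apply: H.
pose R := [set p | `[< S p.1 p.2 >]]%SET.
have RP x y : (x, y) \in R <-> S x y by rewrite inE; split=> /asboolP.
move/bigcapP=> /(_ R) fgR; apply/RP; apply: fgR.
apply/andP; split; last first.
  (* [ab] acts as (3,1,1,1) and [abaaab] as (1,3,3,3). *)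
  apply/RP; right; exists q1, q3 => x.
  have e1 := h0_act [:: La; Lb] x.
  have e2 := h0_act [:: La; Lb; La; La; La; Lb] x.
  by case: x e1 e2 => -[|[|[|[|]]]] //= ? e1 e2; [right|left..];
     split; apply: val_inj.
apply/and4P; split.
- by apply/forallP=> x; apply/RP; left.
- apply/forallP=> x; apply/forallP=> y; apply/implyP=> /RP xy.
  exact/RP/S_sym.
- apply/forallP=> x; apply/forallP=> y; apply/forallP=> z.
  by apply/implyP=> /andP[/RP xy /RP yz]; apply/RP/(S_trans y).
- apply/forallP=> x; apply/forallP=> x'; apply/forallP=> y; apply/forallP=> y'.
  by apply/implyP=> /andP[/RP xx /RP yy]; apply/RP/SM.
Qed.

Lemma h_eq_code (u v : word letter) :
  h u = h v -> code u = code v \/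
  exists p q, all2 (fun i j => (i == p) && (j == q) || (i == q) && (j == p))
                (code u) (code v).
Proof.
move/eqmodP/sim0_swapped => [e|[p [q H]]].
  left; apply/eq_in_map => i; rewrite mem_iota => /= i4.
  by have := h0_act u (Ordinal i4); rewrite e h0_act => ->.
right; exists (val p), (val q).
have W i (i4 : i < 4) :
    (foldl act i u == val p) && (foldl act i v == val q) ||
    (foldl act i u == val q) && (foldl act i v == val p).
  rewrite -(h0_act u (Ordinal i4)) -(h0_act v (Ordinal i4)).
  by case: (H (Ordinal i4)) => -[-> ->]; rewrite !eqxx ?orbT.
by rewrite /= !W.
Qed.

(** An exchange confines the image to the two exchanged values. *)
Lemma h_eq_code_rank3 (u v : word letter) :
  2 < size (undup (code u)) -> h u = h v -> code u = code v.
Proof.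
move=> rk /h_eq_code[//|[p [q]]].
suff sub : all2 (fun i j => (i == p) && (j == q) || (i == q) && (j == p))
             (code u) (code v) -> {subset undup (code u) <= [:: p; q]}.
  by move/sub/uniq_leq_size => /(_ (undup_uniq _)) /(leq_trans rk).
move=> H i; rewrite mem_undup.
elim: (code u) (code v) H => [|j s IH] [|k t] //= /andP[jk /IH{}IH].
rewrite inE => /orP[/eqP->|//]; rewrite !inE.
by case/orP: jk => /andP[-> _]; rewrite ?orbT.
Qed.

(** Both [p] and [q] occur, so they are the exchanged pair; this leaves two explicit codes for the
    fibre. *)
Lemma h_eq_code_rank2 (p q : nat) (u v : word letter) :
  p != q -> p \in code u -> q \in code u -> all (pred2 p q) (code u) ->
  h u = h v ->
  code v = code u \/ code v = [seq if i == p then q else p | i <- code u].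
Proof.
move=> pq pu qu uall /h_eq_code[->|[p' [q' H]]]; [by left|right].
have [ep eq] : {subset code u <= [:: p'; q']} /\
    code v = [seq if i == p' then q' else p' | i <- code u].
  elim: (code u) (code v) H {pu qu uall} => [|j s IH] [|k t] //=.
  move=> /andP[jk /IH[sub ->]].
  split.
    move=> i; rewrite inE => /orP[/eqP->|/sub//]; rewrite !inE.
    by case/orP: jk => /andP[-> _]; rewrite ?orbT.
  congr cons; case/orP: jk => /andP[/eqP-> /eqP->]; rewrite ?eqxx //.
  by case: eqVneq => [->|].
rewrite eq; apply/eq_in_map => i /(allP uall) /= /orP iu.
move: pq (ep _ pu) (ep _ qu); rewrite !inE.
move=> pq /orP[] /eqP ? /orP[] /eqP ?; subst; rewrite ?eqxx // in pq *;
by case: iu => /eqP->; rewrite ?eqxx // ?(negPf pq) // eq_sym (negPf pq).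
Qed.

(** Factors of rank at least 3 are determined by their codes, so a finite check of all cuts of [w]
    suffices. *)
Lemma no_equivalent_split (u v w : word letter) :
    2 < size (undup (code u)) -> 2 < size (undup (code v)) ->
    all (fun i => (code (take i w), code (drop i w)) != (code u, code v))
      (iota 0 (size w).+1) ->
  forall u' v', w = u' ++ v' -> h u = h u' -> h v = h v' -> False.
Proof.
move=> ru rv /allP allw u' v' e /(h_eq_code_rank3 ru) eu /(h_eq_code_rank3 rv) ev.
have /allw : size u' \in iota 0 (size w).+1.
  by rewrite mem_iota e size_cat /= add0n ltnS leq_addr.
by rewrite e take_size_cat // drop_size_cat // eu ev eqxx.
Qed.

(** * Classes that are prime and classes that factor *)

Lemma rel_prime_letter (c : letter) :
  rel_prime Sigma_plus h (rel_class Sigma_plus h [:: c]).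
Proof. by apply: rel_prime_witness => // -[|[|i]]. Qed.

Local Notation q := [:: Lb; La; La; La].

(* [abaab] lies in the class of [ab] but not in [a][b]. *)
Lemma rel_prime_ab : rel_prime Sigma_plus h P_ab.
Proof.
apply: rel_prime_witness => // -[|[|i]] // _ /=.
exists [:: La; Lb; La; La; Lb]; first by split=> //; apply: eq_h_code.
exact: no_equivalent_split.
Qed.

(** [bbaa] and [bbba] act like [baaa]. The first excludes the cuts after one and two letters; since
    [bba] acts like [baa], the last cut needs the second. *)
Lemma rel_prime_q : rel_prime Sigma_plus h P_q.
Proof.
have hq w : code w = code q -> h q = h w by move=> ?; apply: eq_h_code.
apply: rel_prime_witness => // -[|[|[|[|i]]]] // _ /=.
- by exists [:: Lb; Lb; La; La]; [split=> //; apply: hq | apply: no_equivalent_split].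
- by exists [:: Lb; Lb; La; La]; [split=> //; apply: hq | apply: no_equivalent_split].
- by exists [:: Lb; Lb; Lb; La]; [split=> //; apply: hq | apply: no_equivalent_split].
Qed.

(* tau_a identifies the states 2 and 3, and tau_b the states 0 and 2: this forces
   the first letter of [w], and then the value at 2 of the rest. *)
Lemma code_alternating (x y : nat) (w : word letter) :
  x != y -> x != 0 -> code w = [:: x; y; x; y] ->
  exists v, [/\ w = Lb :: v, v != [::] & code v = [:: y; x; y; y]].
Proof.
move=> xy x0; case: w => [|[] w] [].
- by move=> e _ _ _; rewrite -e in x0.
- by move=> _ _ -> e; rewrite e eqxx in xy.
move=> e1 e3 _ e0; exists w; have f2 : foldl act 2 w = y.
  by case: w e1 e3 e0 => [|[] w]; rewrite /act //= => _ <-.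
split=> //; first by apply/eqP=> e; rewrite e /act /= in e3 e0; rewrite -e3 in e0.
by rewrite -[LHS]/[:: foldl act 0 w; foldl act 1 w; foldl act 2 w; foldl act 3 w]
  e0 e1 f2 e3.
Qed.

(** The fibre of [w] has the codes xyxy and yxyx. Either way a member is [b] followed by a word
    coded like [v] or like [v'], and these two share a class. *)
Lemma not_rel_prime_alternating (x y : nat) (w v v' : word letter) :
    x != y -> x != 0 -> y != 0 -> v != [::] ->
    h w = h (Lb :: v) -> h v = h v' ->
    code w = [:: x; y; x; y] -> code v = [:: y; x; y; y] ->
    code v' = [:: x; y; x; x] ->
  ~ rel_prime Sigma_plus h (rel_class Sigma_plus h w).
Proof.
move=> xy x0 y0 vn hw hv cw cv cv'; apply: (@not_rel_prime_cat _ [:: Lb] v) => //.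
  have yx : y == x = false by rewrite eq_sym (negPf xy).
  move=> u hu; have := h_eq_code_rank2 xy _ _ _ hu.
  rewrite cw /= !inE yx !eqxx !orbT => /(_ isT isT isT).
  case=> [/(code_alternating xy x0)|].
    by move=> [t [-> tn ct]]; exists [:: Lb], t; split=> //; apply: eq_h_code; rewrite cv.
  rewrite eq_sym in xy; move=> /(code_alternating xy y0)[t [-> tn ct]].
  by exists [:: Lb], t; split=> //; apply: etrans hv _; apply: eq_h_code; rewrite cv'.
by apply/eqP=> e; rewrite e in cw; case: cw x0 => <-.
Qed.

Lemma not_rel_prime_qb :
  ~ rel_prime Sigma_plus h (rel_class Sigma_plus h (q ++ [:: Lb])).
Proof.
(* [qb] has code 3131; the words [aaab] and [aaabaaab] have codes 1311 and 3133. *)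
apply: (@not_rel_prime_alternating 3 1 _ [:: La; La; La; Lb]
          [:: La; La; La; Lb; La; La; La; Lb]) => //.
exact/esym/(h_aqb_cat [:: La; La] [::]).
Qed.

Lemma not_rel_prime_qq :
  ~ rel_prime Sigma_plus h (rel_class Sigma_plus h (q ++ q)).
Proof.
apply: (@not_rel_prime_alternating 2 1 _ [:: La; La; La; Lb; La; La; La]
          [:: La; La; La; Lb; La; La; La; Lb; La; La; La]) => //.
exact/esym/(h_aqb_cat [:: La; La] [:: La; La; La]).
Qed.

Lemma code_rcons (w : word letter) (c : letter) :
  code (rcons w c) = [seq act i c | i <- code w].
Proof. by rewrite /code -map_comp; apply: eq_map => i /=; rewrite foldl_rcons. Qed.

(** Both codes of the fibre contain 2, reached only from 1 by [a], so each member ends in [a]. What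
    precedes is coded like [abaa] or [abaaabaa], which are congruent. *)
Lemma not_rel_prime_aq :
  ~ rel_prime Sigma_plus h (rel_class Sigma_plus h (La :: q)).
Proof.
(* Numbers beyond 3 go to the default 0, hence never to 1 or 2. *)
have act2 i c : act i c = 2 -> c = La /\ i = 1.
  by case: c i => -[|[|[|[|[]]]]].
have act1 i : act i La = 1 -> i = 0 by case: i => [|[|[|[|[]]]]].
apply: (@not_rel_prime_cat _ [:: La; Lb; La; La] [:: La]) => //.
move=> w /(@h_eq_code_rank2 2 1) => /(_ isT isT isT isT).
case/lastP: w => [[]//|v c]; rewrite code_rcons => cv.
have [ec cv'] : c = La /\ (code v = [:: 1; 0; 0; 0] \/ code v = [:: 0; 1; 1; 1]).
  case: cv; rewrite /code /= => -[e0 e1 e2 e3].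
    have [ec i0] := act2 _ _ e0; rewrite ec in e1 e2 e3.
    by rewrite i0 (act1 _ e1) (act1 _ e2) (act1 _ e3); split=> //; left.
  have [ec i1] := act2 _ _ e1; rewrite ec in e0.
  rewrite (act1 _ e0) i1 (act2 _ _ e2).2 (act2 _ _ e3).2.
  by split=> //; right.
exists v, [:: La]; rewrite -cats1 ec; split=> //.
  by apply/eqP=> e; rewrite e in cv'; case: cv'.
case: cv' => cv'; first by apply: eq_h_code; rewrite cv'.
rewrite -(h_aqb_cat [::] [:: La; La]); apply: eq_h_code; by rewrite cv'.
Qed.

(** * Absorption of copies of [q] *)

Lemma h_flatten_nseq (u v : word letter) i :
  h (u ++ v) = h u -> h (u ++ flatten (nseq i v)) = h u.
Proof.
move=> uv; elim: i => [|i IH]; first by rewrite cats0.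
by rewrite [nseq _ _]/= [flatten _]/= catA h_cat uv -h_cat.
Qed.

Lemma h_aq_nseq i : h (La :: q ++ flatten (nseq i q)) = h (La :: q).
Proof.
apply: (@h_flatten_nseq (La :: q)).
exact: (h_aqb_cat [::] [:: La; La; La]).
Qed.

Lemma h_aqnb m : h (La :: flatten (nseq m q) ++ [:: Lb]) = h [:: La; Lb].
Proof.
case: m => [//|m]; rewrite -[nseq _ _]/(q :: nseq m q) [flatten _]/=.
rewrite -cat_cons h_cat h_aq_nseq -h_cat; exact: h_aqb.
Qed.

(** In [qqq] the middle copy stands between the last [a] of the first and the [b] of the third: the
    pattern [aqb]. *)
Lemma h_qq_nseq i : h (q ++ q ++ flatten (nseq i q)) = h (q ++ q).
Proof.
rewrite catA; apply: h_flatten_nseq.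
exact: (h_aqb_cat [:: Lb; La; La] [:: La; La; La]).
Qed.

Lemma h_qnb i : h (flatten (nseq i.+1 q) ++ [:: Lb]) = h (q ++ [:: Lb]).
Proof.
elim: i => // i IH.
rewrite -[nseq _ _]/(q :: nseq i.+1 q) -[flatten _]/(q ++ flatten (nseq i.+1 q)).
by rewrite -catA h_cat IH -h_cat; exact: (h_aqb_cat [:: Lb; La; La] [::]).
Qed.

(** * Blocks of the right-hand side, and validity *)

Lemma infix_nseq (T : eqType) (x : T) m s1 s s2 :
  nseq m x = s1 ++ s ++ s2 -> s = nseq (size s) x.
Proof.
move=> e; apply/all_pred1P; have := all_pred1_nseq x m.
by rewrite e !all_cat => /and3P[].
Qed.

Lemma infix_nseq_rcons (T : eqType) (x y : T) m s1 s s2 :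
  rcons (nseq m x) y = s1 ++ s ++ s2 ->
  exists i, s = nseq i x \/ s = rcons (nseq i x) y.
Proof.
case/lastP: s2 => [|s2 z]; last first.
  by rewrite -!rcons_cat => /rcons_inj[/infix_nseq e _]; exists (size s); left.
case/lastP: s => [|s z]; first by exists 0; left.
rewrite cats0 -rcons_cat => /rcons_inj[e <-]; exists (size s); right.
by rewrite -(@infix_nseq _ x m s1 s [::]) // cats0.
Qed.

Lemma map_eq_cat (T S : Type) (f : T -> S) ws s1 s2 :
  map f ws = s1 ++ s2 ->
  exists t1 t2, [/\ ws = t1 ++ t2, s1 = map f t1 & s2 = map f t2].
Proof.
move=> e; exists (take (size s1) ws), (drop (size s1) ws).
by rewrite cat_take_drop map_take map_drop e take_size_cat ?drop_size_cat.
Qed.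

Theorem proposition12p2 :
  (forall m : nat, valid Sigma_plus h P_ab (P_a :: nseq m P_q ++ [:: P_b])) /\
  [/\ rel_prime Sigma_plus h P_a, rel_prime Sigma_plus h P_q,
      rel_prime Sigma_plus h P_b & rel_prime Sigma_plus h P_ab].
Proof.
have prime_a := rel_prime_letter La; have prime_b := rel_prime_letter Lb.
split; last by split=> //; [exact: rel_prime_q | exact: rel_prime_ab].
move=> m; set alpha := _ :: _.
have alphaE : alpha =
    map (rel_class Sigma_plus h) ([:: La] :: rcons (nseq m q) [:: Lb]).
  by rewrite /= map_rcons map_nseq -cats1.
split; first split.
- split; [exact: rel_prime_ab | by rewrite /= size_cat addn1 |].
  move=> Q; rewrite inE mem_cat mem_seq1 mem_nseq.
  by case/or3P=> [|/andP[_]|] /eqP-> //; exact: rel_prime_q.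
- rewrite alphaE quot_prod_class /= -cats1 flatten_cat.
  apply: eq_rel_class => //; exact: h_aqnb.
move=> [s1 [s [s2 [e /andP[s_gt1 s_lt]]]]].
move: e s_gt1 s_lt; rewrite {alpha}alphaE => e.
(* Lifting the blocks to lists of words turns the quotient product into the class of a
   concatenation. *)
have [t1 [t' [et _ e']]] := map_eq_cat e.
have [t [t2 [et' -> _]]] := map_eq_cat (esym e').
rewrite quot_prod_class !size_map {e e' s1 s s2}; move: et; rewrite {t'}et'.
have not_prime v w : v != [::] -> w != [::] -> h v = h w ->
    ~ rel_prime Sigma_plus h (rel_class Sigma_plus h w) ->
    ~ rel_prime Sigma_plus h (rel_class Sigma_plus h v).
  by move=> v0 w0 vw; rewrite (eq_rel_class v0 w0 vw).
case: t1 => [|c t1] [].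
  case: t => [//|c t] [<-] et t_gt1.
  (* A proper block starting at [a] stops before the final [b]. *)
  case/lastP: t2 et => [|t2 z] et.
    by rewrite cats0 in et; rewrite -et /= ltnn.
  move: et; rewrite -rcons_cat => /rcons_inj[/(@infix_nseq _ _ _ [::]) et _] _.
  case: t et t_gt1 => [//|w t] [-> ->] _.
  apply: (@not_prime _ (La :: q)) => //; last exact: not_rel_prime_aq.
  exact: h_aq_nseq.
(* Length at least 2 leaves [qb], then two or more copies of [q], then these followed by [b]. *)
move=> _ /infix_nseq_rcons[[|[|i]]] [] -> // _ _.
- apply: (@not_prime _ (q ++ [:: Lb])) => //; exact: not_rel_prime_qb.
- apply: (@not_prime _ (q ++ q)) => //; last exact: not_rel_prime_qq.
  exact: h_qq_nseq.
- apply: (@not_prime _ (q ++ [:: Lb])) => //; last exact: not_rel_prime_qb.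
  by rewrite -cats1 flatten_cat; apply: h_qnb.
Qed.
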